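(* Let $f:\mathbb R^n\to(-\infty,+\infty]$ and $g:\mathbb R^m\to(-\infty,+\infty]$ be proper lower semicontinuous convex functions, let $A\in\mathbb R^{m\times n}$, and assume that the minimax problem $\min_{x\in\mathbb R^n}\max_{y\in\mathbb R^m} f(x)+\langle Ax,y\rangle-g(y)$ has an optimal solution. Let $0<s<\frac1{\|A\|}$ and let $z_k=(x_k,y_k)$, $k\ge 0$, be the iterates of PDHG with step-size $s$ started at an arbitrary point $z_0=(x_0,y_0)\in\mathbb R^n\times\mathbb R^m$. Then for every $k\ge 0$, $$\mathrm{dist}_{P_s^{-1}}^2\bigl(0,\mathcal F(z_{k+1})\bigr)\le \mathrm{dist}_{P_s^{-1}}^2\bigl(0,\mathcal F(z_k)\bigr).$$
   Context: $\|A\|$ is the operator (spectral) norm, with $1/\|A\|=+\infty$ if $A=0$. For $\tau>0$ and convex $h$, $\mathrm{prox}_h^{\tau}(x)=\mathrm{argmin}_{u}\{h(u)+\frac1{2\tau}\|u-x\|_2^2\}$. PDHG (primal-dual hybrid gradient) with step-size $s>0$ is the iteration $$x_{k+1}=\mathrm{prox}_f^{s}(x_k-sA^Ty_k),\qquad y_{k+1}=\mathrm{prox}_g^{s}(y_k+sA(2x_{k+1}-x_k)).$$ For $z=(x,y)$, $\mathcal F(z)=\begin{pmatrix}\partial f(x)+A^Ty\\ -Ax+\partial g(y)\end{pmatrix}\subseteq\mathbb R^{n+m}$, where $\partial$ is the convex subdifferential. An optimal solution of the minimax problem is a point $z$ with $0\in\mathcal F(z)$ (equivalently, a saddle point). $P_s=\begin{pmatrix}\frac1sI_n&-A^T\\-A&\frac1sI_m\end{pmatrix}$,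 which is positive definite for $0<s<1/\|A\|$. For positive definite $M$, $\|u\|_M=\sqrt{u^TMu}$ and $\mathrm{dist}_M(z,\mathcal S)=\inf_{u\in\mathcal S}\|u-z\|_M$ (equal to $+\infty$ if $\mathcal S=\emptyset$). The quantity $\mathrm{dist}^2_{P_s^{-1}}(0,\mathcal F(z))$ is called the infimal sub-differential size (IDS) at $z$. *)

(* Defs.v *)
From mathcomp Require Import all_boot all_order all_algebra.
From mathcomp Require Import all_classical all_reals all_analysis.

Set Implicit Arguments.
Unset Strict Implicit.
Unset Printing Implicit Defensive.

Import Order.TTheory GRing.Theory Num.Theory.
Import numFieldNormedType.Exports.

Local Open Scope classical_set_scope.
Local Open Scope ring_scope.

Section Vectors.
Context {R : realType}.

Definition dotv n (u v : 'cV[R]_n) : R := (u^T *m v) 0 0.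

Definition wnorm n (M : 'M[R]_n) (u : 'cV[R]_n) : R :=
  Num.sqrt (dotv u (M *m u)).

(* The library norm on matrices is the sup norm, hence these definitions. *)
Definition norm2 n (u : 'cV[R]_n) : R := Num.sqrt (dotv u u).

Definition opnorm m n (A : 'M[R]_(m, n)) : R :=
  sup [set norm2 (A *m u) | u in [set u : 'cV[R]_n | norm2 u <= 1]].

(* Infimum in the extended reals: +oo when S is empty. *)
Definition wdist n (M : 'M[R]_n) (z : 'cV[R]_n) (S : set 'cV[R]_n) : \bar R :=
  ereal_inf [set (wnorm M (u - z))%:E | u in S].

End Vectors.

Section ConvexAnalysis.
Context {R : realType} {n : nat}.
Implicit Type h : 'cV[R]_n -> \bar R.

Definition proper_fun h : Prop :=
  (forall x, h x != -oo%E) /\ (exists x, (h x < +oo)%E).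

(* For proper h the right-hand side never involves +oo + -oo; at t = 0 or 1
   the convention 0 * +oo = 0 makes the inequality trivial. *)
Definition econvex_fun h : Prop :=
  forall (x y : 'cV[R]_n) (t : R), 0 <= t <= 1 ->
    (h (t *: x + (1 - t) *: y)%R <= t%:E * h x + (1 - t)%:E * h y)%E.

(* For proper h this set is empty wherever h is +oo. *)
Definition subdiff h (x : 'cV[R]_n) : set 'cV[R]_n :=
  [set v | forall u, (h x + (dotv v (u - x))%:E <= h u)%E].

(* Set of minimizers; a singleton when tau > 0 and h is proper, lower
   semicontinuous and convex. *)
Definition prox h (tau : R) (x : 'cV[R]_n) : set 'cV[R]_n :=
  let obj u := (h u + ((2 * tau)^-1 * norm2 (u - x) ^+ 2)%:E)%E in
  [set u | forall v, (obj u <= obj v)%E].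

End ConvexAnalysis.

Section PDHG.
Context {R : realType} {n m : nat}.
Context (f : 'cV[R]_n -> \bar R) (g : 'cV[R]_m -> \bar R).
Context (A : 'M[R]_(m, n)).

(* z = (x, y) is stacked as col_mx x y. *)
Definition kkt (z : 'cV[R]_(n + m)) : set 'cV[R]_(n + m) :=
  let x := usubmx z in let y := dsubmx z in
  [set w | exists p q, [/\ subdiff f x p, subdiff g y q &
                           w = col_mx (p + A^T *m y) (- (A *m x) + q)]].

Definition pdhg (s : R) (x : nat -> 'cV[R]_n) (y : nat -> 'cV[R]_m) : Prop :=
  forall k,
    prox f s (x k - s *: (A^T *m y k)) (x k.+1) /\
    prox g s (y k + s *: (A *m (2 *: x k.+1 - x k))) (y k.+1).

Definition Pmx (s : R) : 'M[R]_(n + m) :=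
  block_mx (s^-1)%:M (- A^T) (- A) (s^-1)%:M.

Definition ids (s : R) (z : 'cV[R]_(n + m)) : \bar R :=
  (wdist (invmx (Pmx s)) 0 (kkt z) ^+ 2)%E.

End PDHG.

(* Main.v *)
(** Put [d = z_k - z_{k+1}].  The optimality conditions of the two prox steps
    say exactly that [P_s d] belongs to [F(z_{k+1})], so the distance at
    [z_{k+1}] is at most [|P_s d|] in the norm of [P_s^-1], i.e. the norm of [d]
    for [P_s].  Conversely, for every [w] in [F(z_k)], monotonicity of [F] gives
    [<w, d> >= <P_s d, d>], and Cauchy-Schwarz for the dual norms of [P_s^-1] and
    [P_s] turns this into [|w| >= |d|]. *)

Require Import Defs.
From mathcomp Require Import all_boot all_order all_algebra.
From mathcomp Require Import all_classical all_reals all_analysis.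
From mathcomp Require Import ring lra.
Import Order.TTheory GRing.Theory Num.Theory.
Import numFieldNormedType.Exports.
Local Open Scope ring_scope.

(** * Euclidean inner product, positive definite forms, operator norm *)

Section Dot.
Context {R : realType}.

Lemma dotvE {n} (u v : 'cV[R]_n) : dotv u v = \sum_i u i 0 * v i 0.
Proof. by rewrite /dotv mxE; apply: eq_bigr => i _; rewrite mxE. Qed.

Lemma dotvC {n} (u v : 'cV[R]_n) : dotv u v = dotv v u.
Proof. by rewrite !dotvE; apply: eq_bigr => i _; rewrite mulrC. Qed.

Lemma dotvDr {n} (u v w : 'cV[R]_n) : dotv u (v + w) = dotv u v + dotv u w.
Proof. by rewrite /dotv mulmxDr mxE. Qed.

Lemma dotvZr {n} a (u v : 'cV[R]_n) : dotv u (a *: v) = a * dotv u v.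
Proof. by rewrite /dotv -scalemxAr mxE. Qed.

Lemma dotvNr {n} (u v : 'cV[R]_n) : dotv u (- v) = - dotv u v.
Proof. by rewrite -scaleN1r dotvZr mulN1r. Qed.

Lemma dotvDl {n} (u v w : 'cV[R]_n) : dotv (v + w) u = dotv v u + dotv w u.
Proof. by rewrite !(dotvC _ u) dotvDr. Qed.

Lemma dotvZl {n} a (u v : 'cV[R]_n) : dotv (a *: v) u = a * dotv v u.
Proof. by rewrite !(dotvC _ u) dotvZr. Qed.

Lemma dotvNl {n} (u v : 'cV[R]_n) : dotv (- v) u = - dotv v u.
Proof. by rewrite !(dotvC _ u) dotvNr. Qed.

Definition dotv_lin := (@dotvDl, @dotvDr, @dotvZl, @dotvZr, @dotvNl, @dotvNr).

Lemma dotv_trmx {n m} (M : 'M[R]_(m, n)) u v :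
  dotv u (M *m v) = dotv (M^T *m u) v.
Proof. by rewrite /dotv trmx_mul trmxK mulmxA. Qed.

Lemma dotv_col_mx {n m} (a c : 'cV[R]_n) (b d : 'cV[R]_m) :
  dotv (col_mx a b) (col_mx c d) = dotv a c + dotv b d.
Proof. by rewrite /dotv tr_col_mx mul_row_col mxE. Qed.

Lemma dotv_ge0 {n} (u : 'cV[R]_n) : 0 <= dotv u u.
Proof. by rewrite dotvE sumr_ge0// => i _; rewrite -expr2 sqr_ge0. Qed.

Lemma dotv_eq0 {n} (u : 'cV[R]_n) : (dotv u u == 0) = (u == 0).
Proof.
apply/eqP/eqP => [|->]; last by rewrite /dotv mulmx0 mxE.
rewrite dotvE => /psumr_eq0P u0; apply/matrixP => i j.
rewrite ord1 mxE; apply/eqP; rewrite -sqrf_eq0 expr2 u0//.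
by move=> k _; rewrite -expr2 sqr_ge0.
Qed.

Lemma dotv_gt0 {n} (u : 'cV[R]_n) : u != 0 -> 0 < dotv u u.
Proof. by rewrite lt0r dotv_ge0 dotv_eq0 andbT. Qed.

Lemma norm2_ge0 {n} (u : 'cV[R]_n) : 0 <= norm2 u.
Proof. exact: sqrtr_ge0. Qed.

Lemma sqr_norm2 {n} (u : 'cV[R]_n) : norm2 u ^+ 2 = dotv u u.
Proof. by rewrite sqr_sqrtr// dotv_ge0. Qed.

Lemma norm2_gt0 {n} (u : 'cV[R]_n) : u != 0 -> 0 < norm2 u.
Proof. by move=> u0; rewrite sqrtr_gt0 dotv_gt0. Qed.

Lemma norm2Z {n} a (u : 'cV[R]_n) : norm2 (a *: u) = `|a| * norm2 u.
Proof. by rewrite /norm2 !dotv_lin mulrA -expr2 sqrtrM ?sqr_ge0// sqrtr_sqr. Qed.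

(** Symmetry is required separately: over the reals a positive quadratic form does not imply it. *)
Definition posdefmx {n} (M : 'M[R]_n) : Prop :=
  M^T = M /\ forall u, u != 0 -> 0 < dotv u (M *m u).

Lemma posdefmx_ge0 {n} (M : 'M[R]_n) u : posdefmx M -> 0 <= dotv u (M *m u).
Proof.
case=> _ M_gt0; have [->|/M_gt0/ltW//] := eqVneq u 0.
by rewrite mulmx0 /dotv mulmx0 mxE.
Qed.

Lemma posdefmx_unit {n} (M : 'M[R]_n) : posdefmx M -> M \in unitmx.
Proof.
case=> Msym M_gt0; rewrite -row_free_unit -kermx_eq0.
apply/rowV0P => w /sub_kermxP wM0; apply/eqP/negPn/negP => w0.
have : 0 < dotv w^T (M *m w^T) by apply: M_gt0; rewrite trmx_eq0.
by rewrite /dotv trmxK mulmxA wM0 mul0mx mxE ltxx.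
Qed.

Lemma posdefmx_CauchySchwarz {n} (M : 'M[R]_n) u v : posdefmx M ->
  dotv u (M *m v) ^+ 2 <= dotv u (M *m u) * dotv v (M *m v).
Proof.
move=> Mpos; have [->|v0] := eqVneq v 0.
  by rewrite mulmx0 /dotv !mulmx0 mxE mulr0 expr0n.
have c_gt0 := Mpos.2 _ v0.
have vMu : dotv v (M *m u) = dotv u (M *m v) by rewrite dotv_trmx Mpos.1 dotvC.
(* With [a], [b], [c] the values of the form at [(u, u)], [(u, v)], [(v, v)], its value at
   [c u - b v] is [c (a c - b^2)], and [c > 0]. *)
have := posdefmx_ge0 M (dotv v (M *m v) *: u - dotv u (M *m v) *: v) Mpos.
rewrite mulmxDr mulmxN -!scalemxAr !dotv_lin vMu => h.
rewrite -subr_ge0 -(pmulr_rge0 _ c_gt0); apply: le_trans h _.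
by rewrite le_eqVlt; apply/orP; left; apply/eqP; ring.
Qed.

Lemma CauchySchwarz_dotv {n} (u v : 'cV[R]_n) :
  dotv u v ^+ 2 <= dotv u u * dotv v v.
Proof.
have := @posdefmx_CauchySchwarz n 1%:M u v; rewrite !mul1mx; apply.
by split=> [|w w0]; rewrite ?trmx1// mul1mx dotv_gt0.
Qed.

Lemma CauchySchwarz_norm2 {n} (u v : 'cV[R]_n) :
  dotv u v <= norm2 u * norm2 v.
Proof.
rewrite (le_trans (ler_norm _))// -ler_sqr ?nnegrE//; last first.
  by rewrite mulr_ge0 ?norm2_ge0.
by rewrite exprMn !sqr_norm2 real_normK ?num_real// CauchySchwarz_dotv.
Qed.

(* [sup] of an unbounded set is 0, so boundedness has to be established before
   [opnorm] can be used. *)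
Lemma opnorm_has_sup {n m} (A : 'M[R]_(m, n)) :
  has_sup [set norm2 (A *m u) | u in [set u : 'cV[R]_n | norm2 u <= 1]]%classic.
Proof.
split.
  by exists (norm2 (A *m 0)); exists 0 => //=; rewrite /norm2 /dotv mulmx0 mxE sqrtr0 ler01.
(* The bound is the Frobenius norm of [A], by Cauchy-Schwarz on each row. *)
exists (Num.sqrt (\sum_i dotv (row i A)^T (row i A)^T)) => _ [u /= u1 <-].
rewrite ler_wsqrtr// dotvE ler_sum// => i _.
have -> : (A *m u) i 0 = dotv (row i A)^T u.
  by rewrite /dotv trmxK -row_mul [RHS]mxE.
rewrite -expr2 (le_trans (CauchySchwarz_dotv _ _))// ler_piMr ?dotv_ge0//.
by rewrite -sqr_norm2 expr_le1// norm2_ge0.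
Qed.

Lemma opnorm_ge0 {n m} (A : 'M[R]_(m, n)) : 0 <= opnorm A.
Proof.
have [_ Abd] := opnorm_has_sup A.
apply: le_trans (norm2_ge0 (A *m 0)) _; apply: ub_le_sup => //.
by exists 0 => //=; rewrite /norm2 /dotv mulmx0 mxE sqrtr0 ler01.
Qed.

Lemma norm2_mulmx_le {n m} (A : 'M[R]_(m, n)) u :
  norm2 (A *m u) <= opnorm A * norm2 u.
Proof.
have [->|u0] := eqVneq u 0.
  by rewrite mulmx0 /norm2 /dotv !mulmx0 !mxE sqrtr0 mulr0.
have nu := norm2_gt0 _ u0.
rewrite -ler_pdivrMr// mulrC -[X in X * _]ger0_norm ?invr_ge0 ?norm2_ge0//.
rewrite -norm2Z scalemxAr; apply: ub_le_sup; first exact: (opnorm_has_sup A).2.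
exists ((norm2 u)^-1 *: u) => //=.
by rewrite norm2Z ger0_norm ?invr_ge0 ?norm2_ge0// mulVf// gt_eqF.
Qed.

End Dot.

(** * Subgradients and the optimality condition of the proximal step *)

Section Subdiff.
Context {R : realType} {n : nat}.
Implicit Types h : 'cV[R]_n -> \bar R.

Lemma subdiff_fin_num h u p : proper_fun h -> subdiff h u p -> h u \is a fin_num.
Proof.
move=> [hNy [v hv]] /(_ v) uv; rewrite fin_numE hNy/=.
by apply/negP => /eqP hu; move: uv; rewrite hu addye// leye_eq => /eqP hvy;
  move: hv; rewrite hvy ltxx.
Qed.

(** Add the two subgradient inequalities, each tested at the other point; the values of [h] are
    finite and cancel. *)
Lemma subdiff_monotone h u v p q : proper_fun h ->
  subdiff h u p -> subdiff h v q -> 0 <= dotv (p - q) (u - v).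
Proof.
move=> hprop hp hq.
have := subdiff_fin_num _ _ _ hprop hp; have := subdiff_fin_num _ _ _ hprop hq.
move: (hp v) (hq u) => /[swap]; move: (h u) (h v) => [a| |] [b| |]// + + _ _.
by rewrite -!EFinD !lee_fin -[v - u]opprB !dotv_lin; lra.
Qed.

(** Fermat's rule, proved directly: compare the minimizer [u] with points of the segment from [u] to
    [v], bound [h] there by convexity, divide by the step [t] and let [t] be small. *)
Lemma prox_subdiff h tau w u : 0 < tau -> proper_fun h -> econvex_fun h ->
  prox h tau w u -> subdiff h u (tau^-1 *: (w - u)).
Proof.
move=> tau0 [hNy [v0 hv0]] hconv min_u v.
have hu : h u \is a fin_num.
  rewrite fin_numE hNy/=; apply/negP => /eqP hu.
  have /= := min_u v0; rewrite hu addye// leye_eq => /eqP.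
  by case: (h v0) hv0 (hNy v0).
have [->|hv] := eqVneq (h v) +oo%E; first by rewrite leey.
have {}hv : h v \is a fin_num by rewrite fin_numE hNy.
rewrite -(fineK hu) -(fineK hv) -EFinD lee_fin.
set a := fine (h u); set b := fine (h v).
set c := (2 * tau)^-1; set D := dotv (v - u) (v - u).
have D0 : 0 <= D := dotv_ge0 _.
have c0 : 0 < c by rewrite invr_gt0 mulr_gt0.
(* The linear part of the quadratic increment yields the subgradient term; its second-order part
   leaves the error [t * (c * D)]. *)
have step t : 0 < t <= 1 -> a + dotv (tau^-1 *: (w - u)) (v - u) <= b + t * (c * D).
  move=> /andP[t0 t1].
  have := hconv v u t; rewrite (ltW t0) t1 => /(_ isT).
  rewrite -(fineK hu) -(fineK hv) -!EFinM -EFinD -/a -/b => hc.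
  have := le_trans (min_u (t *: v + (1 - t) *: u)) (leeD hc (lexx _)).
  rewrite -(fineK hu) -!EFinD lee_fin -/a -/c !sqr_norm2.
  have -> : t *: v + (1 - t) *: u - w = t *: (v - u) - (w - u).
    by rewrite scalerBl scale1r scalerBr !addrA opprB addrAC; rewrite -!addrA;
      congr (_ + _); rewrite [RHS]addrCA addrC -addrA [- w + _]addrC.
  have -> : u - w = - (w - u) by rewrite opprB.
  have tauE : tau^-1 = 2 * c by rewrite /c invfM mulrA divff// mul1r.
  rewrite tauE -/D; move: @D D0 => /=; move: (v - u) (w - u) => d e D0.
  rewrite !dotvDl !dotvDr !dotvNl !dotvNr !dotvZl !dotvZr (dotvC e d) => ht; rewrite -(ler_pM2l t0).
  move: ht; lra.
rewrite leNgt; apply/negP => ab.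
set X := a + _ in step ab.
have K1 : 0 < c * D + 1 by rewrite ltr_wpDl// mulr_ge0// ltW.
have [t [t01 tK]] : exists t, 0 < t <= 1 /\ t * (c * D + 1) <= X - b.
  (* The [+ 1] keeps the denominator positive when [D = 0] and makes the error [t * (c * D)]
     strictly smaller than the gap [X - b], contradicting [step]. *)
  exists (Num.min 1 ((X - b) / (c * D + 1))); split.
    by rewrite lt_min ltr01 divr_gt0 ?subr_gt0//= ge_min lexx.
  by rewrite -ler_pdivlMr// ge_min lexx orbT.
by have := step t t01; case/andP: t01 => t0 _; lra.
Qed.

End Subdiff.

(** * The matrix [P_s], the KKT operator and the PDHG step *)

Section PDHG.
Context {R : realType} {n m : nat}.
Context (f : 'cV[R]_n -> \bar R) (g : 'cV[R]_m -> \bar R).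
Context (A : 'M[R]_(m, n)).

Lemma Pmx_col_mx s (x : 'cV[R]_n) (y : 'cV[R]_m) :
  Pmx A s *m col_mx x y =
  col_mx (s^-1 *: x - A^T *m y) (s^-1 *: y - A *m x).
Proof.
by rewrite /Pmx mul_block_col !mul_scalar_mx !mulNmx [- _ + _]addrC.
Qed.

(** The cross term [2 <y, A x>] is at most [opnorm A * (|x|^2 + |y|^2)], which the diagonal
    dominates because [opnorm A < s^-1]. *)
Lemma Pmx_posdef s : 0 < s -> s * opnorm A < 1 -> posdefmx (Pmx A s).
Proof.
move=> s0 sA; split.
  by rewrite /Pmx tr_block_mx !tr_scalar_mx !linearN/= trmxK.
move=> z z0; rewrite -[z]vsubmxK Pmx_col_mx dotv_col_mx.
set x := usubmx z; set y := dsubmx z.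
rewrite !dotvDr !dotvNr !dotvZr dotv_trmx trmxK [dotv (A *m x) y]dotvC.
have xy : 0 < dotv x x + dotv y y by rewrite -dotv_col_mx vsubmxK dotv_gt0.
have yAx : dotv y (A *m x) <= norm2 y * (opnorm A * norm2 x).
  apply: le_trans (CauchySchwarz_norm2 _ _) _.
  by rewrite ler_wpM2l ?norm2_ge0 ?norm2_mulmx_le.
have A_lt : opnorm A < s^-1 by rewrite -[s^-1]mul1r ltr_pdivlMr// mulrC.
move: xy; rewrite -!sqr_norm2 => xy.
have amgm : opnorm A * (2 * (norm2 x * norm2 y)) <=
    opnorm A * (norm2 x ^+ 2 + norm2 y ^+ 2).
  rewrite ler_wpM2l ?opnorm_ge0// -subr_ge0.
  by apply: le_trans (sqr_ge0 (norm2 x - norm2 y)) _; lra.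
have : opnorm A * (norm2 x ^+ 2 + norm2 y ^+ 2) <
    s^-1 * (norm2 x ^+ 2 + norm2 y ^+ 2) by rewrite ltr_pM2r.
lra.
Qed.

(** The coupling part of the operator is linear and skew-symmetric, so its contribution cancels and
    only the monotone subdifferentials of [f] and [g] remain. *)
Lemma kkt_monotone z z' w w' : proper_fun f -> proper_fun g ->
  kkt f g A z w -> kkt f g A z' w' -> 0 <= dotv (w - w') (z - z').
Proof.
move=> f_proper g_proper [p [q [fp gq ->]]] [p' [q' [fp' gq' ->]]].
have := subdiff_monotone _ _ _ _ _ f_proper fp fp'.
have := subdiff_monotone _ _ _ _ _ g_proper gq gq'.
have -> : z - z' = col_mx (usubmx z - usubmx z') (dsubmx z - dsubmx z').
  by rewrite -add_col_mx -opp_col_mx !vsubmxK.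
move: (usubmx z) (dsubmx z) (usubmx z') (dsubmx z') => x y x' y'.
rewrite !opp_col_mx !add_col_mx dotv_col_mx !opprD !opprK.
rewrite !dotvDl !dotvDr !dotvNl !dotvNr.
rewrite !(dotvC (A^T *m _)) !dotv_trmx !trmxK.
lra.
Qed.

(** The extrapolation [2 x_{k+1} - x_k] is what makes the dual row come out as
    [s^-1 (y_k - y_{k+1}) - A (x_k - x_{k+1})], hence the symmetric block [- A] of [P_s]. *)
Lemma pdhg_kkt s x y k : 0 < s -> proper_fun f -> proper_fun g ->
  econvex_fun f -> econvex_fun g -> pdhg f g A s x y ->
  kkt f g A (col_mx (x k.+1) (y k.+1))
    (Pmx A s *m (col_mx (x k) (y k) - col_mx (x k.+1) (y k.+1))).
Proof.
move=> s0 f_proper g_proper f_convex g_convex /(_ k)[].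
move=> /(prox_subdiff _ _ _ _ s0 f_proper f_convex) fp.
move=> /(prox_subdiff _ _ _ _ s0 g_proper g_convex) gq.
do 2 eexists; split; rewrite ?col_mxKu ?col_mxKd; [exact: fp|exact: gq|].
rewrite opp_col_mx add_col_mx Pmx_col_mx; congr col_mx.
  rewrite mulmxBr; apply/colP => i.
  move: (A^T *m _) (A^T *m _) => p q; rewrite !mxE.
  by field; rewrite gt_eqF.
rewrite !mulmxBr -scalemxAr; apply/colP => i.
move: (A *m _) (A *m _) => p q; rewrite !mxE.
by field; rewrite gt_eqF.
Qed.

End PDHG.

(** * Weighted norms and their duality *)

Section Wdist.
Context {R : realType} {n : nat}.
Implicit Types (M : 'M[R]_n) (S : set 'cV[R]_n).

Lemma wnorm_invmx_mul M u : posdefmx M -> wnorm (invmx M) (M *m u) = wnorm M u.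
Proof.
move=> Mpos; rewrite /wnorm mulmxA mulVmx ?posdefmx_unit// mul1mx.
by rewrite dotvC.
Qed.

Lemma wdist_ge0 M z S : (0 <= wdist M z S)%E.
Proof. by apply: le_ereal_inf_tmp => _ [u _ <-]; rewrite lee_fin sqrtr_ge0. Qed.

(** Writing [w = M u] turns the dual norm of [w] into the [M]-norm of [u], so Cauchy-Schwarz for [M]
    alone suffices. *)
Lemma wnorm_le_dual M d w : posdefmx M ->
  dotv d (M *m d) <= dotv w d -> wnorm M d <= wnorm (invmx M) w.
Proof.
move=> Mpos; have [u ->] : exists u, w = M *m u.
  by exists (invmx M *m w); rewrite mulKVmx ?posdefmx_unit.
have Mud : dotv (M *m u) d = dotv u (M *m d) by rewrite dotv_trmx Mpos.1.
rewrite wnorm_invmx_mul// Mud => dw.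
have := posdefmx_CauchySchwarz M u d Mpos; have := posdefmx_ge0 M u Mpos.
have := posdefmx_ge0 M d Mpos; rewrite /wnorm.
move: dw; set a := dotv d _; set b := dotv u _; set c := dotv u _.
(* From [a <= b] and [b^2 <= c * a] follows [a^2 <= c * a]; the case [a = 0] is split off so that
   [a] can be cancelled. *)
move=> ab; rewrite le0r => /predU1P[-> c0 _|a0 c0 bca]; first exact: ler_wsqrtr.
rewrite ler_wsqrtr// -(ler_pM2r a0) (le_trans _ bca)// -expr2 ler_sqr// nnegrE.
  exact: ltW.
exact: le_trans (ltW a0) ab.
Qed.

End Wdist.

Theorem proposition1 (R : realType) (n m : nat)
  (f : 'cV[R]_n -> \bar R) (g : 'cV[R]_m -> \bar R) (A : 'M[R]_(m, n))
  (f_proper : proper_fun f) (f_lsc : lower_semicontinuous f)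
  (f_convex : econvex_fun f)
  (g_proper : proper_fun g) (g_lsc : lower_semicontinuous g)
  (g_convex : econvex_fun g)
  (has_opt : exists z : 'cV[R]_(n + m), kkt f g A z 0)
  (s : R) (s_gt0 : 0 < s) (s_lt : (s%:E < ((opnorm A)%:E)^-1)%E)
  (x : nat -> 'cV[R]_n) (y : nat -> 'cV[R]_m) (xy_pdhg : pdhg f g A s x y)
  (k : nat) :
  (ids f g A s (col_mx (x k.+1) (y k.+1)) <= ids f g A s (col_mx (x k) (y k)))%E.
Proof.
have sA : s * opnorm A < 1.
  (* When [opnorm A = 0] the upper bound on [s] is [+oo], but the product is simply [0]. *)
  have [A0|A0] := eqVneq (opnorm A) 0; first by rewrite A0 mulr0.
  move: s_lt; rewrite inver (negbTE A0) lte_fin => s_lt.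
  by rewrite -ltr_pdivlMr ?mul1r// lt0r A0 opnorm_ge0.
have Ppos := Pmx_posdef A s s_gt0 sA.
have kkt1 := pdhg_kkt f g A s x y k s_gt0 f_proper g_proper f_convex g_convex
  xy_pdhg.
set z := col_mx (x k) (y k) in kkt1 *.
set z1 := col_mx (x k.+1) (y k.+1) in kkt1 *.
rewrite /ids lee_sqr// ?inE ?wdist_ge0//.
(* It suffices to bound the norm of each [w] in [F(z_k)]; if there is none, the right-hand distance
   is [+oo]. *)
apply: le_ereal_inf_tmp => _ [w zw <-]; rewrite subr0.
apply: le_trans (_ : (wnorm (Pmx A s) (z - z1))%:E <= _)%E.
  apply: ereal_inf_lbound; exists (Pmx A s *m (z - z1)) => //.
  by rewrite subr0 wnorm_invmx_mul.
rewrite lee_fin wnorm_le_dual//.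
have := kkt_monotone f g A _ _ _ _ f_proper g_proper zw kkt1.
by rewrite dotvDl dotvNl subr_ge0 [X in X <= _]dotvC.
Qed.
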